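(* Let $q$ be a prime power, $n\geq 5$ and $a\in\mathbb{F}_{q^n}$. Then the function $F:\mathbb{F}_{q^n}\to\mathbb{F}_{q^n}$, $F(x)=\mathrm{Tr}(x)^2+ax^2$, is not planar on $\mathbb{F}_{q^n}$.
   Context: $\mathrm{Tr}=\mathrm{Tr}_{\mathbb{F}_{q^n}/\mathbb{F}_q}$. A function $F:\mathbb{F}_{q^n}\to\mathbb{F}_{q^n}$ is called planar (perfect nonlinear) if for every $y\in\mathbb{F}_{q^n}^*$ the map $x\mapsto F(x+y)-F(x)-F(y)$ is a permutation of $\mathbb{F}_{q^n}$. *)

(* Defs.v *)
From HB Require Import structures.
From mathcomp Require Import all_boot all_order all_fingroup all_algebra.
From mathcomp Require Import all_solvable all_field.

Set Implicit Arguments.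
Unset Strict Implicit.
Unset Printing Implicit Defensive.

Import GRing.Theory.
Local Open Scope ring_scope.

Definition planar (V : zmodType) (F : V -> V) : Prop :=
  forall y : V, y != 0 -> bijective (fun x : V => F (x + y) - F x - F y).

(* The trace of L over its base field K; its values lie in the copy 1%AS of K
   inside L.  Over a finite K every finite extension carries a
   splittingFieldType structure (via finvect_type) and is Galois
   (finField_galois), so this is the usual trace Tr_(F_{q^n} / F_q). *)
Definition Tr (K : fieldType) (L : splittingFieldType K) (x : L) : L :=
  galTrace 1%AS {:L}%AS x.

(* Main.v *)
(* Suppose q = 2h + 1 is odd, a <> 0, and put b = - 1/a.  It suffices to find
   x <> 0 with g(x) = Tr(x) Tr(b/x) = 1: then y = b/x satisfies
   Tr(x) Tr(y) + a x y = 0, so the difference map of F at y identifies x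
   with 0.  As g(x) lies in F_q, if g never took the value 1 then
   g + g^2 + ... + g^(q-1) would vanish on all x <> 0.  Expanding
   Tr(x) = sum_i x^(q^i), consider the coefficient of x^e in this sum,
   e = h (1 + q - q^2 - q^3).  Comparing base-q digits modulo q^n - 1, for
   n >= 5 this exponent only arises from g^(q-1), and in a unique way; the
   coefficient is binomial(q-1, h)^2 b^(h q^2 + h q^3) = b^(h q^2 + h q^3),
   which is nonzero. *)
Require Import Defs.
From HB Require Import structures.
From mathcomp Require Import all_boot all_order all_fingroup all_algebra.
From mathcomp Require Import all_solvable all_field.
From mathcomp Require Import ring zify.

Set Implicit Arguments.
Unset Strict Implicit.
Unset Printing Implicit Defensive.

Import Order.TTheory GRing.Theory Num.Theory.
Local Open Scope ring_scope.

(** * Signed base-q digits and their carries *)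

(** [c] is the sequence of carries, [m] entering at the bottom and [m'] leaving at the top.
    Splitting off the lowest digit gives the next carry [m1]; digits may be negative. *)
Lemma base_carries (q : nat) n (d : nat -> int) (m m' : int) : (0 < q)%N ->
    \sum_(i < n) d i * q%:Z ^+ i + m = q%:Z ^+ n * m' ->
  exists c : nat -> int,
    [/\ c 0%N = m, c n = m' & forall i, (i < n)%N -> d i = q%:Z * c i.+1 - c i].
Proof.
move=> q_gt0; elim: n d m => [|n IHn] d m.
  rewrite big_ord0 add0r expr0 mul1r => eq_mm'.
  by exists (fun=> m); split; rewrite ?eq_mm'.
rewrite big_ord_recl expr0 mulr1 => def_m'.
pose S := \sum_(i < n) d i.+1 * q%:Z ^+ i.
pose m1 := q%:Z ^+ n * m' - S.
have defS : \sum_(i < n) d (bump 0 i) * q%:Z ^+ bump 0 i = q%:Z * S.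
  rewrite mulr_sumr; apply: eq_bigr => i _.
  by rewrite /bump leq0n add1n exprS mulrCA.
have def_d0 : d 0%N = q%:Z * m1 - m.
  by rewrite mulrBr mulrA -exprS -def_m' defS; ring.
have [|c [c0 cn dc]] := IHn (fun i => d i.+1) m1; first by rewrite addrC subrK.
exists (fun i => if i is i'.+1 then c i' else m); split=> // - [|i] lt_in.
  by rewrite c0.
exact: dc.
Qed.

Lemma sum_eq0_pm1 n (C : 'I_n -> int) :
    (forall i, `|C i| <= 1) -> \sum_i C i = 0 -> (exists i, C i != 0) ->
  (exists i, C i = 1) /\ (exists j, C j = -1).
Proof.
move=> leC1 sumC0 [k Ck].
have ex1 (D : 'I_n -> int) : (forall i, `|D i| <= 1) -> \sum_i D i = 0 ->
    D k != 0 -> exists i, D i = 1.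
  move=> leD1 sumD0 Dk; have [/existsP[i /eqP Di]|] := boolP [exists i, D i == 1].
    by exists i.
  rewrite negb_exists => /forallP neqD1.
  have leD0 i : true -> 0 <= - D i by move=> _; have := neqD1 i; have := leD1 i; lia.
  have /(psumr_eq0P leD0) /(_ k isT) : \sum_i - D i = 0 by rewrite sumrN sumD0 oppr0.
  by move/eqP; rewrite oppr_eq0 (negPf Dk).
split; first exact: ex1.
have [|||j /eqP] := ex1 (fun i => - C i); first by move=> i; rewrite normrN.
- by rewrite sumrN sumC0 oppr0.
- by rewrite oppr_eq0.
by rewrite eqr_oppLR => /eqP; exists j.
Qed.

Section Balanced.
Variables (h n k : nat) (u v : nat -> nat).
Local Notation q := h.*2.+1.
Hypotheses (h_gt0 : (0 < h)%N) (n_ge5 : (5 <= n)%N) (le_k2h : (k <= h.*2)%N).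
Hypotheses (sum_u : (\sum_(i < n) u i = k)%N) (sum_v : (\sum_(i < n) v i = k)%N).

(** The signed base-q digits of e = h (1 + q - q^2 - q^3). *)
Let delta (i : nat) : int :=
  if (i < 2)%N then h%:Z else if (i < 4)%N then - h%:Z else 0.

Let deltaP i : (i < 2)%N /\ delta i = h%:Z \/
  (2 <= i < 4)%N /\ delta i = - h%:Z \/ (4 <= i)%N /\ delta i = 0.
Proof.
rewrite /delta; have [i_lt2 | i_ge2] := ltnP i 2; first by left.
by have [i_lt4 | i_ge4] := ltnP i 4; right; [left | right].
Qed.

Let le1 (w : nat -> nat) i :
  (\sum_(j < n) w j = k)%N -> (i < n)%N -> (w i <= k)%N.
Proof. by move=> <- lt_in; rewrite (bigD1 (Ordinal lt_in)) //= leq_addr. Qed.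

Let le2 (w : nat -> nat) i j : (\sum_(l < n) w l = k)%N ->
  (i < n)%N -> (j < n)%N -> i != j -> (w i + w j <= k)%N.
Proof.
move=> <- lt_in lt_jn neq_ij; rewrite (bigD1 (Ordinal lt_in)) //=.
by rewrite (bigD1 (Ordinal lt_jn)) ?addnA ?leq_addr //= -val_eqE /= eq_sym.
Qed.

(* A vector w with sum_i w_i q^i = 0 mod q^n - 1 has the form
   w_i = q c_(i+1) - c_i with c cyclic; the bounds on u and v confine c to
   {-1, 0, 1}, and then each sign can occur at most once. *)
Let carries_eq0 (c : nat -> int) : c 0%N = c n ->
    (forall i, (i < n)%N -> (u i)%:Z - (v i)%:Z = q%:Z * c i.+1 - c i + delta i) ->
  forall i, (i < n)%N -> c i.+1 = 0.
Proof.
move=> c0n cE.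
have B1 i : (i < n)%N -> `|q%:Z * c i.+1 - c i + delta i| <= (h.*2)%:Z.
  by move=> lt_in; rewrite -cE //; have := le1 sum_u lt_in; have := le1 sum_v lt_in; lia.
have B2 i j : (i < n)%N -> (j < n)%N -> i != j ->
    `|q%:Z * c i.+1 - c i + delta i + (q%:Z * c j.+1 - c j + delta j)| <= (h.*2)%:Z.
  move=> lt_in lt_jn neq_ij; rewrite -!cE //.
  by have := le2 sum_u lt_in lt_jn neq_ij; have := le2 sum_v lt_in lt_jn neq_ij; lia.
have n_gt0 : (0 < n)%N by lia.
(* At a carry y of maximal modulus, q|y| <= |y| + 3h by [B1]; as q - 1 = 2h, this gives |y| <= 1. *)
have c_le1 i : (i <= n)%N -> `|c i| <= 1.
  have [/= i0 _ max_i0] := @arg_maxnP _ (Ordinal n_gt0) predT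
    (fun i : 'I_n => `|c i.+1|%N) isT.
  have le_max j : (j <= n)%N -> (`|c j| <= `|c i0.+1|)%N.
    case: j => [_|j lt_jn]; last exact: (max_i0 (Ordinal lt_jn) isT).
    rewrite c0n; have lt_n1 : (n.-1 < n)%N by rewrite prednK.
    by have := max_i0 (Ordinal lt_n1) isT; rewrite /= prednK.
  move=> /le_max; suff : (`|c i0.+1| <= 1)%N by lia.
  have := B1 i0 (ltn_ord i0); have := le_max i0 (ltnW (ltn_ord i0)).
  have : `|delta i0| <= h%:Z by have := deltaP i0; lia.
  move: (c i0) (c i0.+1) (delta i0) => x y z le_zh le_xy le_h.
  have [//|y_gt1] := leqP `|y| 1.
  have le_hy : (h * 2 <= h * `|y|)%N by rewrite leq_mul2l y_gt1 orbT.
  have : (`|(q%:Z * y)%R| <= `|x| + h * 3)%N by lia.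
  by rewrite abszM; lia.
have cyc i : (i < n)%N -> exists j, [/\ (j < n)%N, c j.+1 = c i &
    (j.+1 == i) || (i == 0%N) && (j == n.-1)].
  case: i => [_|i lt_in]; last by exists i; rewrite eqxx ltnW.
  by exists n.-1; rewrite ltn_predL prednK // !eqxx orbT.
(* Summing [cE] over a cycle gives (q - 1) times the sum of the carries, since [u], [v] have equal
   totals and [delta] has total 0. *)
have sum_c : \sum_(i < n) c i.+1 = 0.
  have sum_cr : \sum_(i < n) c i.+1 = \sum_(i < n) c i.
    have : c 0%N + \sum_(i < n) c i.+1 = \sum_(i < n) c i + c n.
      by rewrite -(big_ord_recl n (fun i => c i)) big_ord_recr.
    by rewrite c0n addrC => /addIr.
  have : \sum_(i < n) ((u i)%:Z - (v i)%:Z) = 0.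
    by rewrite sumrB -!(big_morph Posz PoszD (erefl _)) sum_u sum_v subrr.
  under eq_bigr do rewrite cE //.
  rewrite big_split sumrB -mulr_sumr -sum_cr /=.
  have -> : \sum_(i < n) delta i = 0.
    rewrite -(subnKC n_ge5) !big_ord_recl big1 ?addr0 /delta //=; lia.
  rewrite addr0 -addn1 PoszD mulrDl mul1r addrK => /eqP.
  by rewrite mulf_eq0 => /orP[|/eqP//]; lia.
(* By [B2], 2q - c_i - c_j + delta_i + delta_j <= 2h, which forces {i, j} = {2, 3} and c_2 = c_3 =
   1; then positions 1 and 2 together exceed the bound. *)
have uniq_p i j : (i < n)%N -> (j < n)%N -> c i.+1 = 1 -> c j.+1 = 1 -> i = j.
  move=> lt_in lt_jn ci cj; apply/eqP/negPn/negP => neq_ij.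
  have := B2 i j lt_in lt_jn neq_ij; rewrite ci cj.
  have := c_le1 i (ltnW lt_in); have := c_le1 j (ltnW lt_jn) => cj1 ci1 bd.
  have [c2 c3] : c 2%N = 1 /\ c 3%N = 1.
    suff: (i = 2 /\ j = 3 \/ i = 3 /\ j = 2)%N.
      by case=> -[ei ej]; rewrite ei ej /delta /= in ci1 cj1 bd; lia.
    by have := deltaP i; have := deltaP j; lia.
  have := B2 1%N 2%N (ltac:(lia)) (ltac:(lia)) isT; have := c_le1 1%N (ltac:(lia)).
  by rewrite c2 c3 /delta /=; lia.
(* Likewise {i, j} = {0, 1} and c_0 = c_1 = -1; the cyclically adjacent positions n - 1 and 0 then
   break the bound. *)
have uniq_m i j : (i < n)%N -> (j < n)%N -> c i.+1 = -1 -> c j.+1 = -1 -> i = j.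
  move=> lt_in lt_jn ci cj; apply/eqP/negPn/negP => neq_ij.
  have := B2 i j lt_in lt_jn neq_ij; rewrite ci cj.
  have := c_le1 i (ltnW lt_in); have := c_le1 j (ltnW lt_jn) => cj1 ci1 bd.
  have [c0 c1] : c 0%N = -1 /\ c 1%N = -1.
    suff: (i = 0 /\ j = 1 \/ i = 1 /\ j = 0)%N.
      by case=> -[ei ej]; rewrite ei ej /delta /= in ci1 cj1 bd; lia.
    by have := deltaP i; have := deltaP j; lia.
  have := B2 n.-1 0%N (ltac:(lia)) n_gt0 (ltac:(lia)); have := c_le1 n.-1 (leq_pred n).
  rewrite prednK // -c0n c0 c1.
  by have := deltaP n.-1; have := deltaP 0%N; lia.
move=> i0 lt_i0n; apply/eqP/negPn/negP => ci0.
have [[i ci] [j cj]] : (exists i : 'I_n, c i.+1 = 1) /\ (exists j : 'I_n, c j.+1 = -1).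
  apply: sum_eq0_pm1 => // [i|]; first exact: c_le1.
  by exists (Ordinal lt_i0n).
have lt_in := ltn_ord i; have lt_jn := ltn_ord j.
have i23 : (2 <= i < 4)%N.
  have [i' [lt_i'n ci' ei']] := cyc i lt_in.
  have neq1 : c i <> 1 by move=> ci1; have := uniq_p i' i lt_i'n lt_in; lia.
  have := B1 i lt_in; have := c_le1 i (ltnW lt_in).
  by rewrite ci; have := deltaP i; lia.
have j01 : (j < 2)%N.
  have [j' [lt_j'n cj' ej']] := cyc j lt_jn.
  have neq1 : c j <> -1 by move=> cj1; have := uniq_m j' j lt_j'n lt_jn; lia.
  have := B1 j lt_jn; have := c_le1 j (ltnW lt_jn).
  by rewrite cj; have := deltaP j; lia.
have neq1 l : (l < n)%N -> l != i -> c l.+1 <> 1.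
  by move=> lt_ln neq cl; have := uniq_p l i lt_ln lt_in cl ci; lia.
have ci_le0 : c i <= 0.
  have [i' [lt_i'n <- ei']] := cyc i lt_in.
  by have := neq1 i' lt_i'n; have := c_le1 i'.+1 lt_i'n; lia.
(* The other position in {0, 1}. Positions i and j' will add up to 2h + 1 - c_i - c_j' >= 2h + 1,
   against [B2]. *)
pose j' := (1 - j)%N; have lt_j'n : (j' < n)%N by lia.
have cj'0 : c j'.+1 = 0.
  have := neq1 j' lt_j'n; have := uniq_m j' j lt_j'n lt_jn; have := c_le1 j'.+1 lt_j'n; lia.
(* Here n >= 5 matters: the position cyclically before 0 is n - 1 >= 4, hence is not i, which is 2
   or 3. *)
have cj'_le0 : c j' <= 0.
  have [l [lt_ln <- el]] := cyc j' lt_j'n.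
  by have := neq1 l lt_ln; have := c_le1 l.+1 lt_ln; lia.
have := B2 i j' lt_in lt_j'n (ltac:(lia)); rewrite ci cj'0.
by have := deltaP i; have := deltaP j'; lia.
Qed.

(* For n = 4 uniqueness fails: h (1 + q - q^2 - q^3) is then also represented
   by u - v = (h - 1, - h - 1, 1 - h, h + 1), through a cyclic carry. *)
Lemma balanced_digits :
    (h * q ^ 2 + h * q ^ 3 + \sum_(i < n) u i * q ^ i
      = h + h * q + \sum_(i < n) v i * q ^ i %[mod (q ^ n).-1])%N ->
  [/\ k = h.*2, (u 0 = h /\ u 1 = h)%N & (v 2 = h /\ v 3 = h)%N].
Proof.
move=> /eqP eq_mod.
pose d i := (u i)%:Z - (v i)%:Z - delta i.
(* Modulo q^n - 1 the top carry re-enters at the bottom, so the same [m] stands on both sides. *)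
have [m dm] : exists m : int, \sum_(i < n) d i * q%:Z ^+ i + m = q%:Z ^+ n * m.
  have PoszX (e : nat) : (q ^ e)%N%:Z = q%:Z ^+ e.
    by rewrite -[LHS]natz natrX natz.
  have sumE (w : nat -> nat) :
      \sum_(i < n) (w i)%:Z * q%:Z ^+ i = (\sum_(i < n) w i * q ^ i)%N%:Z.
    by rewrite (big_morph Posz PoszD (erefl _)); apply: eq_bigr => i _; rewrite PoszM PoszX.
  have sum_delta : \sum_(i < n) delta i * q%:Z ^+ i =
      (h + h * q)%N%:Z - (h * q ^ 2 + h * q ^ 3)%N%:Z.
    rewrite -(subnKC n_ge5) !big_ord_recl big1 /delta //=; last by move=> i; rewrite mul0r.
    by rewrite /bump /= !PoszD !PoszM; ring.
  have /dvdzP[m dm] : ((q ^ n).-1%:Z %|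
      (h * q ^ 2 + h * q ^ 3 + \sum_(i < n) u i * q ^ i)%N%:Z
       - (h + h * q + \sum_(i < n) v i * q ^ i)%N%:Z)%Z.
    by rewrite -eqz_mod_dvd !modz_nat eqz_nat.
  exists m; rewrite -PoszX -(prednK (expn_gt0 q n : (0 < q ^ n)%N)).
  under eq_bigr do rewrite /d !mulrBl.
  rewrite !sumrB !sumE sum_delta.
  rewrite -[((q ^ n).-1).+1]addn1; move: dm; rewrite !PoszD => dm.
  by rewrite mulrDl mul1r [_ * m]mulrC -dm; ring.
have [c [c0 cn dc]] := base_carries (ltn0Sn _) dm.
have cE i : (i < n)%N -> (u i)%:Z - (v i)%:Z = q%:Z * c i.+1 - c i + delta i.
  by move=> lt_in; rewrite -dc // /d; ring.
have c_eq0 := carries_eq0 (etrans c0 (esym cn)) cE.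
have c00 : c 0%N = 0 by rewrite c0 -cn -(ltn_predK n_ge5) c_eq0 //; lia.
have uv i : (i < n)%N -> (u i)%:Z - (v i)%:Z = delta i.
  case: i => [|i] lt_in; rewrite cE // c_eq0 // mulr0 ?c00 ?c_eq0 ?subr0 ?add0r //.
  exact: ltnW.
(* Both u_0 and u_1 are at least h while u_0 + u_1 <= k <= 2h, so equality holds throughout;
   similarly for v_2 and v_3. *)
have := uv 0%N (ltac:(lia)); have := uv 1%N (ltac:(lia)).
have := uv 2%N (ltac:(lia)); have := uv 3%N (ltac:(lia)).
have := le2 sum_u (ltac:(lia) : (0 < n)%N) (ltac:(lia) : (1 < n)%N) isT.
have := le2 sum_v (ltac:(lia) : (2 < n)%N) (ltac:(lia) : (3 < n)%N) isT.
by rewrite /delta /=; clear -le_k2h => *; split; lia.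
Qed.
End Balanced.

(** * Binomials in characteristic p and power sums over roots of unity *)

(** In characteristic p, ['C(q, m.+1)] vanishes for 0 < m + 1 < q, so Pascal's rule flips the sign
    at each step. *)
Lemma bin_pred_pchar (R : nzRingType) (p e m : nat) :
    p \in [pchar R] -> (m < p ^ e)%N ->
  'C((p ^ e).-1, m)%:R = (-1) ^+ m :> R.
Proof.
move=> pcharRp; have p_pr := pcharf_prime pcharRp.
set q := (p ^ e)%N; have q_gt0 : (0 < q)%N by rewrite expn_gt0 prime_gt0.
elim: m => [|m IHm] lt_mq; first by rewrite bin0 expr0.
suff : 'C(q, m.+1)%:R = 0 :> R.
  by rewrite -(prednK q_gt0) binS natrD IHm 1?ltnW // exprS mulN1r
    => /eqP; rewrite addr_eq0 => /eqP.
apply/eqP; rewrite -(dvdn_pcharf pcharRp); apply/negPn/negP => ndvd.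
have : (q %| m.+1 * 'C(q, m.+1))%N by rewrite -mul_bin_diag dvdn_mulr.
rewrite Gauss_dvdl; first by move/(dvdn_leq (ltn0Sn m)); rewrite leqNgt lt_mq.
by rewrite coprimeXl // prime_coprime.
Qed.

Lemma prim_root_neq0 (F : fieldType) (N : nat) (z : F) :
  N.-primitive_root z -> z != 0.
Proof.
move=> prim_z; apply/eqP => z0; have /eqP := prim_expr_order prim_z.
by rewrite z0 expr0n gtn_eqF ?(prim_order_gt0 prim_z) // eq_sym oner_eq0.
Qed.

(** A geometric sum in z^A / z^B. This orthogonality extracts coefficients; two exponents [A] and
    [B] avoid negative powers. *)
Lemma prim_root_expr_sum (F : fieldType) (N : nat) (z : F) (A B : nat) :
    N.-primitive_root z ->
  \sum_(j < N) (z ^+ j) ^+ A / (z ^+ j) ^+ B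
    = if A == B %[mod N] then N%:R else 0.
Proof.
move=> prim_z; have N_gt0 := prim_order_gt0 prim_z.
have zX_neq0 m : z ^+ m != 0 by rewrite expf_neq0 ?(prim_root_neq0 prim_z).
pose w := z ^+ A / z ^+ B.
have termE (j : 'I_N) : (z ^+ j) ^+ A / (z ^+ j) ^+ B = w ^+ j.
  by rewrite expr_div_n -!exprM ![(j * _)%N]mulnC.
under eq_bigr do rewrite termE.
have w1 : (w == 1) = (A == B %[mod N]).
  by rewrite -(eq_prim_root_expr prim_z) -(divr1 1) /w eqr_div ?oner_eq0 // mulr1 mul1r.
rewrite -w1; case: ifP => [/eqP-> | /negbT].
  by under eq_bigr do rewrite expr1n; rewrite sumr_const card_ord.
rewrite -subr_eq0 => w1_neq0; apply: (mulfI w1_neq0).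
rewrite -subrX1 mulr0 /w expr_div_n -!exprM ![(_ * N)%N]mulnC !exprM.
by rewrite (prim_expr_order prim_z) !expr1n divr1 subrr.
Qed.

(** * Exponents in the expansion of a power of a sum *)

Section Fibres.
Variables (k n : nat).
Implicit Types (f : {ffun 'I_k -> 'I_n}).

(** [f] records which summand is taken from each of [k] factors, so [fibre_size f i] is the
    multiplicity of summand [i]; multinomial coefficients become counts of maps. *)
Definition fibre_size f (i : nat) := #|[set t | f t == i :> nat]|.

Lemma sum_fibre_size f (w : nat -> nat) :
  (\sum_(i < n) fibre_size f i * w i = \sum_t w (f t))%N.
Proof.
rewrite [RHS](partition_big f predT) //=; apply: eq_bigr => i _.
rewrite (eq_bigr (fun=> w i)) => [|t /eqP->//].
by rewrite sum_nat_const; congr (_ * _)%N; apply: eq_card => t; rewrite inE.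
Qed.

Lemma sum_fibre_size1 f : (\sum_(i < n) fibre_size f i = k)%N.
Proof.
have := sum_fibre_size f (fun=> 1%N); rewrite sum1_card card_ord => sum_k.
by rewrite -[RHS]sum_k; apply: eq_bigr => i _; rewrite muln1.
Qed.
End Fibres.

Definition halved h n (i j : nat) : {pred {ffun 'I_h.*2 -> 'I_n}} :=
  [pred f | (fibre_size f i == h) && (fibre_size f j == h)].

Arguments halved : clear implicits.

(** Two disjoint fibres of size h exhaust the 2h points, so [f] takes only the values [i] and
    [j]. *)
Lemma halvedP h n (i j : nat) (f : {ffun 'I_h.*2 -> 'I_n}) : i != j ->
  f \in halved h n i j -> forall t, (f t == j :> nat) = (f t != i :> nat).
Proof.
move=> neq_ij /andP[/eqP fi /eqP fj] t.
pose A i := [set t | f t == i :> nat].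
have disjA : A i :&: A j = set0.
  by apply/setP=> u; rewrite !inE; apply/negP => /andP[/eqP->]; apply/negP.
have : A i :|: A j = setT.
  apply/eqP; rewrite eqEcard subsetT cardsT card_ord cardsU disjA cards0 subn0.
  by rewrite [#|A i|]fi [#|A j|]fj addnn leqnn.
move/setP/(_ t); move/setP/(_ t): disjA; rewrite /A !inE.
by case: (_ == i :> nat); case: (_ == j :> nat).
Qed.

Lemma card_halved h n (i j : 'I_n) : i != j -> #|halved h n i j| = 'C(h.*2, h).
Proof.
move=> neq_ij; rewrite -[in RHS](card_ord h.*2) -card_draws.
pose F (A : {set 'I_h.*2}) := [ffun t => if t \in A then i else j].
have fibF A : [set t | F A t == i :> nat] = A /\ [set t | F A t == j :> nat] = ~: A.
  by split; apply/setP=> t; rewrite !inE ffunE; case: ifP => _;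
     rewrite val_eqE ?eqxx // ?(negPf neq_ij) // eq_sym (negPf neq_ij).
have injF : injective F by move=> A B eqF; rewrite -(fibF A).1 eqF (fibF B).1.
rewrite -(card_imset _ injF); apply: eq_card => f; apply/idP/imsetP => [fP | [A]].
  exists [set t | f t == i :> nat]; first by rewrite inE; case/andP: fP.
  apply/ffunP=> t; rewrite ffunE inE; apply/val_inj; case: ifP => [/eqP // | /negbT ft].
  by apply/eqP; rewrite (halvedP _ fP).
rewrite inE => /eqP cardA ->; apply/andP; rewrite /fibre_size !(fibF A).1 (fibF A).2.
by rewrite cardA eqxx cardsCs setCK card_ord cardA -addnn addnK.
Qed.

(** * The trace as a polynomial *)

Section TracePowers.
Variables (F : fieldType) (q n : nat).

Definition powtr (x : F) := \sum_(i < n) x ^+ (q ^ i).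

Lemma powtr_exprE (k : nat) x :
  powtr x ^+ k =
    \sum_(f : {ffun 'I_k -> 'I_n}) x ^+ (\sum_(i < n) fibre_size f i * q ^ i).
Proof.
transitivity (\prod_(t < k) powtr x); first by rewrite prodr_const card_ord.
rewrite bigA_distr_bigA; apply: eq_bigr => f _.
by rewrite prodrXr sum_fibre_size.
Qed.

Lemma powtr_shift x : x ^+ (q ^ n) = x -> powtr (x ^+ q) = powtr x.
Proof.
move=> xqn; rewrite /powtr; under eq_bigr do rewrite -exprM -expnS.
apply: (addrI (x ^+ (q ^ 0))).
by rewrite -(big_ord_recl n (fun i => x ^+ (q ^ i))) big_ord_recr /= xqn addrC.
Qed.

(** Being fixed by the q-th power expresses that the trace lies in the field of q elements. *)
Lemma powtr_frob p e x : p \in [pchar F] -> q = (p ^ e)%N ->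
  x ^+ (q ^ n) = x -> powtr x ^+ q = powtr x.
Proof.
move=> pcharFp def_q xqn; have p_pr := pcharf_prime pcharFp.
have pcharq : [pchar F].-nat q by rewrite def_q pnatX pnatE // pcharFp.
have frobD : {morph (fun y : F => y ^+ q) : y y' / y + y'}.
  by move=> y y'; rewrite exprDn_pchar.
have frob0 : 0 ^+ q = 0 :> F by rewrite expr0n gtn_eqF // def_q expn_gt0 prime_gt0.
rewrite -[RHS]powtr_shift // {1}/powtr (big_morph _ frobD frob0).
by apply: eq_bigr => i _; rewrite -!exprM mulnC.
Qed.
End TracePowers.

(** * The coefficient of x^e in the powers of g *)

Section KeySum.
Variables (F : fieldType) (p e h n : nat) (z b : F).
Local Notation q := h.*2.+1.
Local Notation N := (q ^ n).-1.
Local Notation tr := (powtr q n).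
Hypotheses (h_gt0 : (0 < h)%N) (n_ge5 : (5 <= n)%N).
Hypotheses (pcharFp : p \in [pchar F]) (def_q : q = (p ^ e)%N).
Hypotheses (prim_z : N.-primitive_root z) (b_neq0 : b != 0).
Hypothesis frobF : forall x : F, x ^+ (q ^ n) = x.

(** N times the coefficient of x^e in g^k, exponents being taken modulo N: the sum of x^(-e) g(x)^k
    over x = z^j. *)
Let T k := \sum_(j < N) (z ^+ j) ^+ (h * q ^ 2 + h * q ^ 3)
  / (z ^+ j) ^+ (h + h * q) * (tr (z ^+ j) * tr (b / z ^+ j)) ^+ k.

Let E k (f : {ffun 'I_k -> 'I_n}) := (\sum_(i < n) fibre_size f i * q ^ i)%N.

Let TE k : T k = \sum_(f : {ffun 'I_k -> 'I_n}) \sum_(g : {ffun 'I_k -> 'I_n})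
  if h * q ^ 2 + h * q ^ 3 + E f == h + h * q + E g %[mod N]
  then b ^+ E g * N%:R else 0.
Proof.
transitivity (\sum_(j < N) \sum_(f : {ffun 'I_k -> 'I_n})
    \sum_(g : {ffun 'I_k -> 'I_n}) b ^+ E g *
     ((z ^+ j) ^+ (h * q ^ 2 + h * q ^ 3 + E f) / (z ^+ j) ^+ (h + h * q + E g))).
  apply: eq_bigr => j _; rewrite exprMn !powtr_exprE mulr_suml mulr_sumr.
  apply: eq_bigr => f _; rewrite !mulr_sumr; apply: eq_bigr => g _.
  have zj_neq0 m : (z ^+ j) ^+ m != 0 by rewrite !expf_neq0 ?(prim_root_neq0 prim_z).
  rewrite -/(E f) -/(E g) expr_div_n ![_ ^+ (_ + E _)]exprD.
  by field; rewrite ?zj_neq0.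
rewrite exchange_big; apply: eq_bigr => f _.
rewrite exchange_big; apply: eq_bigr => g _ /=.
by rewrite -mulr_sumr (prim_root_expr_sum _ _ prim_z); case: ifP; rewrite ?mulr0.
Qed.

Let T_small k : (k < h.*2)%N -> T k = 0.
Proof.
move=> lt_k; rewrite TE big1 // => f _; rewrite big1 // => g _.
case: eqP => // /(balanced_digits h_gt0 n_ge5 (ltnW lt_k)
  (sum_fibre_size1 f) (sum_fibre_size1 g)) [eq_k].
by rewrite eq_k ltnn in lt_k.
Qed.

Let T_top : T h.*2 != 0.
Proof.
have lt_n i : (i < 5)%N -> (i < n)%N by move/leq_trans; apply.
pose o i (lt_i5 : (i < 5)%N) := Ordinal (lt_n i lt_i5).
pose P (f : {ffun 'I_h.*2 -> 'I_n}) i j : bool := f \in halved h n i j.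
have E_halved f i j : i != j -> P f i j -> E f = (h * q ^ i + h * q ^ j)%N.
  move=> neq_ij Pf; have ft := halvedP neq_ij Pf; rewrite /E sum_fibre_size.
  transitivity (fibre_size f i * q ^ i + fibre_size f j * q ^ j)%N; last first.
    by case/andP: Pf => /eqP-> /eqP->.
  rewrite /fibre_size -!sum1dep_card !big_distrl !(big_mkcond (fun t => _ == _)) -big_split /=.
  apply: eq_bigr => t _; rewrite ft !mul1n.
  have := ft t; have [->|_ /eqP->] := eqVneq (f t : nat) i => //.
  by rewrite addn0.
have condP f g : h * q ^ 2 + h * q ^ 3 + E f = h + h * q + E g %[mod N] ->
    P f 0%N 1%N && P g 2 3.
  move=> /(balanced_digits h_gt0 n_ge5 (leqnn _)
    (sum_fibre_size1 f) (sum_fibre_size1 g)) [_ [f0 f1] [g2 g3]].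
  by rewrite /P !inE f0 f1 g2 g3 eqxx.
have -> : T h.*2 = \sum_(f | P f 0%N 1%N) \sum_(g | P g 2 3)
   b ^+ (h * q ^ 2 + h * q ^ 3) * N%:R.
  rewrite TE [RHS]big_mkcond; apply: eq_bigr => f _.
  case: ifP => Pf; last first.
    by rewrite big1 // => g _; case: eqP => // /condP; rewrite Pf.
  rewrite [RHS]big_mkcond; apply: eq_bigr => g _.
  case: eqP => [/condP|] /=; case: ifP => Pg; rewrite ?Pf //.
    by rewrite (E_halved g 2 3).
  rewrite (E_halved f 0%N 1%N) // (E_halved g 2 3) // expn0 expn1 muln1.
  by rewrite [in RHS]addnC; case.
(* The count is ['C(q.-1, h)], which is a sign in characteristic p and hence nonzero. *)
have cardP (i j : 'I_n) : i != j -> #|[pred f | P f i j]|%:R = (-1) ^+ h :> F.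
  move=> neq_ij; rewrite -(bin_pred_pchar (e := e) pcharFp) -def_q /=.
    by rewrite -(card_halved _ neq_ij).
  by rewrite ltnS -addnn leq_addr.
rewrite sumr_const sumr_const -mulrnA -[_ *+ _]mulr_natr natrM.
rewrite (cardP (o 0%N isT) (o 1%N isT)) // (cardP (o 2 isT) (o 3 isT)) //.
by rewrite !mulf_neq0 ?expf_neq0 ?oppr_eq0 ?oner_eq0 // (prim_root_natf_neq0 prim_z).
Qed.

Lemma powtr_prod1 : exists2 x, x != 0 & tr x * tr (b / x) = 1.
Proof.
have [/existsP[j /eqP trj]|] := boolP [exists j : 'I_N, tr (z ^+ j) * tr (b / z ^+ j) == 1].
  by exists (z ^+ j); rewrite ?expf_neq0 ?(prim_root_neq0 prim_z).
rewrite negb_exists => /forallP tr_neq1; case/negP: T_top; apply/eqP.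
have sumT0 : \sum_(k < h.*2) T k.+1 = 0.
  rewrite exchange_big big1 // => j _ /=; rewrite -mulr_sumr.
  set g := tr _ * _; rewrite [X in _ * X](_ : _ = 0) ?mulr0 //.
  (* (g - 1)(g + ... + g^(q-1)) = g^q - g = 0, while g differs from 1. *)
  apply: (@mulfI _ (g - 1)); first by rewrite subr_eq0 tr_neq1.
  under eq_bigr do rewrite exprS.
  rewrite -mulr_sumr mulrCA -subrX1 mulr0 mulrBr mulr1 -exprS.
  by rewrite exprMn !(powtr_frob pcharFp def_q) ?subrr.
rewrite -sumT0; case: {sumT0} h h_gt0 T_small => // h' _ T0.
rewrite doubleS big_ord_recr /= big1 ?add0r // => k _; apply: T0.
by rewrite doubleS ltnS; apply: ltn_ord.
Qed.
End KeySum.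

(** * Trace, Frobenius and primitive elements of the finite extension *)

(** The Galois group is cyclic, generated by Frobenius, of order the degree. *)
Lemma trace_powtr (Fq : finFieldType) (L : splittingFieldType Fq) (x : L) :
  Tr x = powtr #|Fq| (\dim {:L}) x.
Proof.
have [alpha gen_alpha alphaE] := finField_galois_generator (sub1v {:L}).
rewrite /Tr /galTrace (eqP gen_alpha).
have ord_alpha : #[alpha]%g = \dim {:L}.
  by rewrite orderE -(eqP gen_alpha) -galois_dim ?finField_galois ?sub1v // dimv1 divn1.
have alphaX i : (alpha ^+ i)%g x = x ^+ (#|Fq| ^ i).
  elim: i => [|i IHi]; first by rewrite expg0 gal_id expn0.
  by rewrite expgSr galM ?memvf // IHi rmorphXn /= alphaE ?memvf // dimv1 expn1 -exprM expnS.
have -> : <[alpha]>%g = [set (alpha ^+ val i)%g | i : 'I_#[alpha]%g].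
  apply/setP=> y; apply/idP/imsetP => [/cyclePmin[i lt_i ->] | [i _ ->]].
    by exists (Ordinal lt_i).
  exact: mem_cycle.
rewrite big_imset /= => [|i j _ _ /eqP]; last first.
  by rewrite eq_expg_mod_order !modn_small // => /eqP/val_inj.
by rewrite /powtr -ord_alpha; apply: eq_bigr => i _; apply: alphaX.
Qed.

Lemma frob_and_prim_root (Fq : finFieldType) (L : splittingFieldType Fq) :
  (forall x : L, x ^+ (#|Fq| ^ \dim {:L}) = x) /\
  exists z : L, (#|Fq| ^ \dim {:L}).-1.-primitive_root z.
Proof.
(* [M] is a copy of [L] with a finite field structure, in which elements can be counted. *)
pose M := finvect_type L.
pose cM : Vector.axioms_ Fq M := Vector.class L.
have cardM : #|M| = (#|Fq| ^ \dim {:L})%N.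
  by rewrite -(card_vspacef cM) card_vspace.
have frobM (x : M) : x ^+ (#|Fq| ^ \dim {:L}) = x by rewrite -cardM expf_card.
split; first exact: frobM.
have M_gt1 : (1 < #|M|)%N := finNzRing_gt1 M.
have : has ((#|M|).-1.-primitive_root) (enum (predC1 (0 : M))).
  apply: has_prim_root.
  - by rewrite -ltnS prednK // ltnW.
  - apply/allP=> x; rewrite mem_enum => x_neq0.
    apply/unity_rootP/(mulfI x_neq0).
    by rewrite -exprS prednK ?(ltnW M_gt1) // expf_card mulr1.
  - exact: enum_uniq.
  by rewrite -cardE cardC1.
by case/hasP=> z _ prim_z; exists z; rewrite -cardM.
Qed.

Theorem theorem6p15 (p k q n : nat) (hp : prime p) (hk : (0 < k)%N)
    (hq : q = (p ^ k)%N) (hn : (5 <= n)%N)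
    (Fq : finFieldType) (hFq : #|Fq| = q)
    (L : splittingFieldType Fq) (hL : \dim {:L} = n) (a : L) :
  ~ planar (fun x : L => Tr x ^+ 2 + a * x ^+ 2).
Proof.
have [frobL [z prim_z]] := frob_and_prim_root L.
have TrE (x : L) : Tr x = powtr q n x by rewrite trace_powtr hFq hL.
rewrite hFq hL in frobL prim_z.
have pcharLp : p \in [pchar L].
  by rewrite pchar_lalg (card_finPcharP (n := k)) // hFq.
(* The displayed value is the difference map of F at [y], evaluated at [x]; at 0 that map also
   vanishes, so injectivity fails. The factor 2 settles characteristic 2 at once. *)
suff [x [y [x_neq0 y_neq0 xy0]]] :
    exists x y : L, [/\ x != 0, y != 0 & 2%:R * (Tr x * Tr y + a * x * y) = 0].
  move=> /(_ y y_neq0) [G GK _]; case/eqP: x_neq0; apply: (can_inj GK).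
  have TrD : Tr (x + y) = Tr x + Tr y by rewrite /Tr raddfD.
  have Tr0 : Tr (0 : L) = 0 by rewrite /Tr raddf0.
  rewrite /= add0r TrD Tr0.
  transitivity (2%:R * (Tr x * Tr y + a * x * y)); [ring | rewrite xy0; ring].
have q_gt1 : (1 < q)%N by rewrite hq -(exp1n k) ltn_exp2r // prime_gt1.
have [p2 | p_odd] := even_prime hp.
  exists 1, 1; rewrite oner_eq0; split=> //.
  by rewrite -p2 (pcharf0 pcharLp) mul0r.
have [a0 | a_neq0] := eqVneq a 0.
  (* For a = 0 a nonzero element of trace 0 suffices; z^q differs from z because z has order q^n - 1
     > q. *)
  exists (z ^+ q - z), 1; rewrite oner_eq0; split=> //.
    have lt_qN : (q < (q ^ n).-1)%N.
      rewrite -ltnS prednK ?expn_gt0 ?(ltnW q_gt1) // (@leq_trans (q ^ 2)) //.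
        by rewrite -mulnn; nia.
      by rewrite leq_exp2l // (leq_trans _ hn).
    rewrite subr_eq0 -{2}[z]expr1 (eq_prim_root_expr prim_z).
    by rewrite !modn_small ?gtn_eqF // (ltn_trans q_gt1).
  have -> : Tr (z ^+ q - z) = 0.
    have -> : Tr (z ^+ q - z) = Tr (z ^+ q) - Tr z by rewrite /Tr raddfB.
    by rewrite !TrE powtr_shift // subrr.
  by rewrite a0 !mul0r addr0 mulr0.
have q_odd : odd q by rewrite hq oddX p_odd orbT.
pose h := q./2; have def_q : q = h.*2.+1 by rewrite -[LHS]odd_double_half q_odd.
rewrite def_q in TrE frobL prim_z hq q_gt1.
have h_gt0 : (0 < h)%N by rewrite -double_gt0.
have ia_neq0 : - a^-1 != 0 by rewrite oppr_eq0 invr_eq0.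
have [x x_neq0 trx] := powtr_prod1 h_gt0 hn pcharLp hq prim_z ia_neq0 frobL.
exists x, (- a^-1 / x); split=> //; first by rewrite mulf_neq0 ?invr_eq0.
by rewrite !TrE trx; field; rewrite x_neq0 a_neq0.
Qed.
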